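(* For all $k\in\mathbb{N}$ (that is, all integers $k\ge 1$) and all integers $m\ge 0$, $n\ge 0$, $$\int_{[0,+\infty)^k}(e_2(\mathbf{x}))^m\,(e_1(\mathbf{x}))^n\,e^{-e_1(\mathbf{x})}\,d\mathbf{x}=\frac{m!\,(2m+n+k-1)!\,\left(\frac{k}{2}\right)_m}{(2m+k-1)!}\left(\frac{2(k-1)}{k}\right)^m T_k(m),$$ where $$T_k(m)-T_k(m-1)=\frac{(k(k-2))^m\,\left(\frac{k-1}{2}\right)_m}{(k-1)^{2m}\,\left(\frac{k}{2}\right)_m}\,T_{k-1}(m)\qquad\text{for all } k\ge 2,\ m\ge 1,$$ $T_1(m)=0$ for all integers $m\ge 0$, and $T_k(0)=1$ for all $k\ge 2$.
   Context: Here $\mathbf{x}=(x_1,\ldots,x_k)$, $d\mathbf{x}=dx_1\cdots dx_k$, $e_1(\mathbf{x})=\sum_{i=1}^k x_i$, $e_2(\mathbf{x})=\sum_{i<j}x_ix_j$ (sum over $1\le i<j\le k$), and $(y)_m=\prod_{i=0}^{m-1}(y+i)$ is the rising factorial. The numbers $T_k(m)$, for integers $k\ge 1$ and $m\ge 0$, are defined by the recurrence and initial conditions given in the claim.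
   Formalization: The case k = 1, m = 0 is excluded: there e_2^0 = 1, so the integral equals n!, while the right-hand side is 0 because T_1(0) = 0; all other k ≥ 1, m ≥ 0, n ≥ 0 are covered. *)

(* Defs.v *)
From HB Require Import structures.
From mathcomp Require Import all_boot all_order all_algebra.
From mathcomp Require Import all_classical all_reals all_analysis.

Set Implicit Arguments.
Unset Strict Implicit.
Unset Printing Implicit Defensive.

Import Order.TTheory GRing.Theory Num.Theory.
Import numFieldNormedType.Exports.
Local Open Scope classical_set_scope.
Local Open Scope ring_scope.

(* R^k is the type of k-tuples of reals, with the product of the Borel
   sigma-algebras, and its Lebesgue measure is the k-fold product measure,
   transported along the bijection R * R^k -> R^(k+1). *)
Notation Rn R k := (k.-tuple (measurableTypeR R)).

Section tuple_measure.
Variable R : realType.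
Local Open Scope ereal_scope.

Definition consR k (p : measurableTypeR R * Rn R k) : Rn R k.+1 :=
  [the k.+1.-tuple _ of p.1 :: p.2].

Lemma measurable_consR k : measurable_fun setT (@consR k).
Proof. exact: measurable_cons. Qed.

Section step.
Variables (k : nat) (mu : {sigma_finite_measure set (Rn R k) -> \bar R}).

Definition consmu : set (Rn R k.+1) -> \bar R :=
  pushforward (@lebesgue_measure R \x mu) (@consR k).

Let consmu0 : consmu set0 = 0.
Proof. by rewrite /consmu /pushforward preimage_set0 measure0. Qed.

Let consmu_ge0 A : 0 <= consmu A.
Proof. exact: (measure_ge0 (@lebesgue_measure R \x mu)). Qed.

Let consmu_sigma_additive : semi_sigma_additive consmu.
Proof.
move=> F mF tF mUF; rewrite /consmu /pushforward preimage_bigcup.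
have mpre A : measurable A -> measurable (@consR k @^-1` A).
  by move=> mA; rewrite -[X in measurable X]setTI; exact: measurable_consR.
apply: measure_semi_sigma_additive.
- by move=> n; exact: mpre.
- move=> i j _ _ [p [Fi Fj]]; apply: (tF i j) => //.
  by exists (consR p).
- by rewrite -preimage_bigcup; exact: mpre.
Qed.

HB.instance Definition _ := isMeasure.Build _ _ _ consmu
  consmu0 consmu_ge0 consmu_sigma_additive.

Lemma measurable_cons_rect (A : set (measurableTypeR R)) (B : set (Rn R k)) :
  measurable A -> measurable B ->
  measurable [set x : Rn R k.+1 | A (thead x) /\ B [tuple of behead x]].
Proof.
move=> mA mB.
rewrite (_ : [set _ | _] = ((fun x : Rn R k.+1 => thead x) @^-1` A) `&`
  ((fun x : Rn R k.+1 => [tuple of behead x]) @^-1` B)) //.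
apply: measurableI; rewrite -[X in measurable X]setTI.
  exact: (@measurable_tnth _ (measurableTypeR R) k.+1 ord0).
exact: (@measurable_behead _ (measurableTypeR R) k).
Qed.

Lemma consmu_rect (A : set (measurableTypeR R)) (B : set (Rn R k)) :
  measurable A -> measurable B ->
  consmu [set x | A (thead x) /\ B [tuple of behead x]] =
  lebesgue_measure A * mu B.
Proof.
move=> mA mB; rewrite -product_measure1E// /consmu /pushforward.
congr (_ _); apply/seteqP; split => -[a b] /=.
  by rewrite theadE => -[? Bb]; split=> //=; move: Bb; congr B; exact: val_inj.
by rewrite theadE => -[? Bb]; split=> //; move: Bb; congr B; exact: val_inj.
Qed.

Let consmu_sigma_finite : sigma_finite setT consmu.
Proof.
have /sigma_finiteP[F [TF ndF Foo]] := sigma_finiteT (@lebesgue_measure R).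
have /sigma_finiteP[G [TG ndG Goo]] := sigma_finiteT mu.
exists (fun n => [set x | F n (thead x) /\ G n [tuple of behead x]]).
  apply/seteqP; split => // x _.
  have [i _ Fi] : (\bigcup_n F n) (thead x) by rewrite -TF.
  have [j _ Gj] : (\bigcup_n G n) [tuple of behead x] by rewrite -TG.
  exists (maxn i j) => //=; split.
    by move: Fi; apply/subsetPset/ndF; rewrite leq_maxl.
  by move: Gj; apply/subsetPset/ndG; rewrite leq_maxr.
move=> n; have [mF Fn] := Foo n; have [mG Gn] := Goo n.
split; first exact: measurable_cons_rect.
by rewrite consmu_rect// lte_mul_pinfty// ge0_fin_numE.
Qed.

HB.instance Definition _ := Measure_isSigmaFinite.Build _ _ _ consmu
  consmu_sigma_finite.

End step.

Fixpoint lebesgueRn k : {sigma_finite_measure set (Rn R k) -> \bar R} :=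
  match k with
  | 0 => dirac [tuple]
  | k'.+1 => consmu (lebesgueRn k')
  end.

Definition box k (A : 'I_k -> set (measurableTypeR R)) : set (Rn R k) :=
  [set x | forall i, A i (tnth x i)].

Lemma lebesgueRn_box k (A : 'I_k -> set (measurableTypeR R)) :
  (forall i, measurable (A i)) ->
  measurable (box A) /\
  lebesgueRn k (box A) = \prod_(i < k) lebesgue_measure (A i).
Proof.
elim: k A => [|k IH] A mA.
  have -> : box A = setT by apply/seteqP; split => // x _ [].
  by split; [exact: measurableT|rewrite big_ord0 /= diracT].
have [mB muB] := IH (fun i => A (lift ord0 i)) (fun i => mA _).
have -> : box A = [set x : Rn R k.+1 | A ord0 (thead x) /\
    box (fun i => A (lift ord0 i)) [tuple of behead x]].
  apply/seteqP; split => x /=.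
    move=> Ax; split; first exact: Ax.
    by move=> i; move: (Ax (lift ord0 i)); rewrite [x in tnth x _]tuple_eta tnthS.
  move=> [A0 AS] i; case: (unliftP ord0 i) => [j|] -> //.
  by rewrite [x in tnth x _]tuple_eta tnthS; exact: AS.
split; first exact: measurable_cons_rect.
by rewrite /= consmu_rect// muB big_ord_recl.
Qed.

End tuple_measure.

Definition e1 (R : realType) (k : nat) (x : Rn R k) : R :=
  \sum_(i < k) tnth x i.

Definition e2 (R : realType) (k : nat) (x : Rn R k) : R :=
  \sum_(i < k) \sum_(j < k | (i < j)%N) tnth x i * tnth x j.

Definition orthant (R : realType) (k : nat) : set (Rn R k) :=
  [set x | forall i, 0 <= tnth x i].
Arguments orthant : clear implicits.

Definition rising (R : realType) (y : R) (m : nat) : R :=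
  \prod_(i < m) (y + i%:R).

Definition T_coef (R : realType) (k m : nat) : R :=
  (k%:R * (k%:R - 2)) ^+ m * rising ((k%:R - 1) / 2) m /
  ((k%:R - 1) ^+ (2 * m) * rising (k%:R / 2) m).

(* The numbers T_k(m), k >= 1, as a family [T k m]; the values [T 0 m] are
   irrelevant. *)
Definition is_T (R : realType) (T : nat -> nat -> R) : Prop :=
  [/\ forall k m, (2 <= k)%N -> (1 <= m)%N ->
        T k m - T k (m - 1)%N = T_coef R k m * T (k - 1)%N m,
      forall m, T 1%N m = 0
    & forall k, (2 <= k)%N -> T k 0%N = 1].

Lemma is_T_exists (R : realType) : exists T : nat -> nat -> R, is_T T.
Proof.
pose F := fix F k m : R :=
  if k is k'.+1 then
    if (k' == 0)%N then 0 else
    (fix G m := if m is m'.+1 then G m' + T_coef R k m * F k' m else 1) m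
  else 0.
exists F; split => [[|[|k]] [|m] // _ _|m //|[|[|k]] //].
by rewrite !subn1 /= addrAC subrr add0r.
Qed.

Lemma is_T_unique (R : realType) (T T' : nat -> nat -> R) :
  is_T T -> is_T T' -> forall k m, (1 <= k)%N -> T k m = T' k m.
Proof.
move=> [rT T1 T0] [rT' T'1 T'0]; elim=> [//|[|k] IHk] m _.
  by rewrite T1 T'1.
elim: m => [|m IHm]; first by rewrite T0// T'0.
have := rT k.+2 m.+1 isT isT; have := rT' k.+2 m.+1 isT isT.
by rewrite !subn1 /= IHm IHk// => <- /addIr.
Qed.

(* Main.v *)
Require Import Defs.
From HB Require Import structures.
From mathcomp Require Import all_boot all_order all_algebra.
From mathcomp Require Import all_classical all_reals all_analysis.
From mathcomp Require Import measurable_realfun.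
From mathcomp Require Import ring.

Set Implicit Arguments.
Unset Strict Implicit.
Unset Printing Implicit Defensive.

Import Order.TTheory GRing.Theory Num.Theory.
Import numFieldNormedType.Exports.
Local Open Scope classical_set_scope.
Local Open Scope ring_scope.

(* Write [I k m n] for the integral.  Integrating [div (x * f)] over the
   orthant, with [x] the position vector and
   [f = e2 ^+ m * e1 ^+ n * expR (- e1)], gives
   [I k m n.+1 = (2 m + n + k) * I k m n].  Integrating instead the sum of all
   the partial derivatives of [e2 ^+ m.+1 * expR (- e1)], whose boundary terms
   are the integrals over the [k] faces [x_i = 0], gives
   [k * I k m.+1 0 = k * I (k - 1) m.+1 0 + m.+1 * (k - 1) * I k m 1].
   Together they are the recurrence of [T].  Both integrations by parts are
   performed on polynomials: integrating against [expR (- x)] over the half-line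
   is the linear functional ['X^i |-> i`!], and a polynomial in [k] variables is
   an iterated univariate one.  Tonelli's theorem and the binomial formula show
   that this algebraic integral is the Lebesgue integral. *)

(** * Gamma integrals as a linear functional on polynomials *)

Section gamma_functional.
Variable A : comNzRingType.

(* The [A]-linear functional sending ['X^i] to the Gamma integral [i`!]. *)
Definition polyGamma (p : {poly A}) : A := \sum_(i < size p) p`_i *+ i`!.

(** Padding with zero coefficients lets several polynomials share one summation range. *)
Lemma polyGamma_wide N (p : {poly A}) : (size p <= N)%N ->
  polyGamma p = \sum_(i < N) p`_i *+ i`!.
Proof.
move=> pN; rewrite /polyGamma (big_ord_widen _ (fun i => p`_i *+ i`!) pN).
rewrite big_mkcond; apply: eq_bigr => i _; case: ltnP => // pi.
by rewrite nth_default ?mul0rn.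
Qed.

Lemma polyGamma_is_additive : {morph polyGamma : p q / p + q}.
Proof.
move=> p q; have pqN := size_polyD p q.
rewrite (polyGamma_wide pqN) (polyGamma_wide (leq_maxl _ (size q))).
rewrite (polyGamma_wide (leq_maxr (size p) _)) -big_split.
by apply: eq_bigr => i _; rewrite coefD mulrnDl.
Qed.

Lemma polyGamma0 : polyGamma 0 = 0.
Proof. by rewrite /polyGamma size_poly0 big_ord0. Qed.

HB.instance Definition _ := GRing.isNmodMorphism.Build _ _ polyGamma
  (conj polyGamma0 polyGamma_is_additive).

Lemma polyGammaCM c p : polyGamma (c%:P * p) = c * polyGamma p.
Proof.
have cpN : (size (c%:P * p)%R <= size p)%N.
  by rewrite mul_polyC size_scale_leq.
rewrite (polyGamma_wide cpN) mulr_sumr.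
by apply: eq_bigr => i _; rewrite coefCM mulrnAr.
Qed.

Lemma polyGammaXn i : polyGamma 'X^i = (i`!)%:R.
Proof.
rewrite /polyGamma size_polyXn big_ord_recr /= big1 ?add0r ?coefXn ?eqxx//.
by move=> j _; rewrite coefXn ltn_eqF ?mul0rn.
Qed.

(* Integration by parts against [expR (- x)] on the half-line. *)
Lemma polyGamma_deriv p : polyGamma p^`() = polyGamma p - p`_0.
Proof.
have dN : (size p^`() <= (size p).-1)%N by rewrite size_poly.
rewrite (polyGamma_wide dN) (polyGamma_wide (leqSpred (size p))).
rewrite big_ord_recl /= addrC addKr; apply: eq_bigr => i _.
by rewrite coef_deriv -mulrnA -factS.
Qed.

(** The factorial weights are integer multiples, so additivity of [d] suffices. *)
Lemma polyGamma_map (d : {additive A -> A}) p :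
  polyGamma (map_poly d p) = d (polyGamma p).
Proof.
have dN : (size (map_poly d p) <= size p)%N by rewrite size_poly.
rewrite (polyGamma_wide dN) raddf_sum; apply: eq_bigr => i _.
by rewrite coef_map raddfMn.
Qed.

End gamma_functional.

(** * Derivations and their coefficientwise extension to polynomials *)

Definition is_derivation (A : comNzRingType) (d : A -> A) :=
  forall x y, d (x * y) = d x * y + x * d y.

Section derivations.
Variable A : comNzRingType.

Lemma derivation1 (d : A -> A) : is_derivation d -> d 1 = 0.
Proof.
move=> /(_ 1 1) /eqP; rewrite !mul1r mulr1 -subr_eq0 opprD addNKr.
by rewrite oppr_eq0 => /eqP.
Qed.

Lemma derivationXn (d : A -> A) x n : is_derivation d ->
  d (x ^+ n) = d x * x ^+ n.-1 *+ n.
Proof.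
move=> dM; elim: n => [|n IH]; first by rewrite expr0 derivation1 ?mulr0n.
case: n IH => [|n] /= IH; first by rewrite expr1 expr0 mulr1.
by rewrite exprS dM IH /= exprS; ring.
Qed.

(** Coefficients of a product are convolutions, to which the Leibniz rule applies termwise. *)
Lemma derivation_map (d : {additive A -> A}) : is_derivation d ->
  is_derivation (map_poly d).
Proof.
move=> dM p q; apply/polyP => i; rewrite coefD !coefM coef_map coefM.
rewrite raddf_sum -big_split; apply: eq_bigr => j _ /=.
by rewrite !coef_map dM.
Qed.

Lemma derivation_mapX (d : {additive A -> A}) : is_derivation d ->
  map_poly d 'X = 0.
Proof.
move=> dM; apply/polyP => i; rewrite coef_map coefX coef0.
by case: (i == 1)%N; rewrite ?raddf0//=; exact: derivation1.
Qed.

End derivations.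

(** * Iterated polynomials and the two integrations by parts *)

Section iterated_polynomials.
Variable R : comNzRingType.

(** The outermost ['X] stands for the head coordinate, as in [consR]. *)
Fixpoint polyn k : comNzRingType := if k is k'.+1 then {poly (polyn k')} else R.

(* Integration over the orthant against the exponential weight. *)
Fixpoint pint k : {additive polyn k -> R} :=
  match k with
  | 0 => idfun
  | k'.+1 => (pint k') \o @polyGamma (polyn k')
  end.

Fixpoint pe1 k : polyn k :=
  match k with
  | 0 => 0
  | k'.+1 => (pe1 k')%:P + 'X
  end.

Fixpoint pe2 k : polyn k :=
  match k with
  | 0 => 0
  | k'.+1 => (pe2 k')%:P + (pe1 k')%:P * 'X
  end.

(* The sum of all partial derivatives. *)
Fixpoint pdiv k : {additive polyn k -> polyn k} :=
  match k with
  | 0 => \0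
  | k'.+1 => map_poly (pdiv k') \+ (@deriv (polyn k'))
  end.

(* The Euler operator, the sum of the [x_i] times the [i]-th partial. *)
Fixpoint peuler k : {additive polyn k -> polyn k} :=
  match k with
  | 0 => \0
  | k'.+1 => map_poly (peuler k') \+ ('X \*o (@deriv (polyn k')))
  end.

(* The sum over [i] of the integrals over the face [x_i = 0]. *)
Fixpoint pbound k : {additive polyn k -> R} :=
  match k with
  | 0 => \0
  | k'.+1 => (pbound k' \o @polyGamma (polyn k')) \+ (pint k' \o coefp 0)
  end.

Lemma pdiv_derivation k : is_derivation (@pdiv k).
Proof.
elim: k => [|k IH] p q /=; first by rewrite mul0r mulr0 addr0.
by rewrite (derivation_map IH) derivM; ring.
Qed.

Lemma peuler_derivation k : is_derivation (@peuler k).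
Proof.
elim: k => [|k IH] p q /=; first by rewrite mul0r mulr0 addr0.
by rewrite (derivation_map IH) derivM; ring.
Qed.

Lemma pdiv_pe1 k : pdiv k (pe1 k) = k%:R.
Proof.
elim: k => //= k IH.
rewrite derivD derivC derivX add0r raddfD /= map_polyC /= IH.
by rewrite (derivation_mapX (@pdiv_derivation k)) addr0 polyC_natr natr1.
Qed.

(** The [i]-th partial of [x_i * p] is [p] plus [x_i] times that of [p], and [x_i * p] vanishes on
    the face [x_i = 0], so no boundary term appears. *)
Lemma pint_euler k p : pint k (peuler k p) + pint k p *+ k = pint k (pe1 k * p).
Proof.
elim: k p => [|k IH] p /=; first by rewrite mul0r addr0.
rewrite !raddfD /= mulrDl !raddfD /= polyGamma_map polyGammaCM -IH.
have := polyGamma_deriv ('X * p).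
rewrite derivM derivX mul1r raddfD /= coefXM subr0 => <-.
rewrite raddfD /= mulrSr; ring.
Qed.

Lemma pint_div k p : pint k (pdiv k p) = pint k p *+ k - pbound k p.
Proof.
elim: k p => [|k IH] p /=; first by rewrite subr0.
by rewrite !raddfD /= polyGamma_map IH polyGamma_deriv raddfB mulrSr; ring.
Qed.


(** Each partial of [e2] is [e1 - x_i]; the additive form avoids truncated subtraction. *)
Lemma pdiv_pe2 k : pdiv k (pe2 k) + pe1 k = pe1 k *+ k.
Proof.
elim: k => [|k IH] /=; first by rewrite addr0.
rewrite raddfD /= map_polyC /= (derivation_map (@pdiv_derivation k)).
rewrite map_polyC /= pdiv_pe1 (derivation_mapX (@pdiv_derivation k)) mulr0.
rewrite derivD derivM !derivC derivX mulr1 mul0r !addr0 !add0r.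
rewrite -[pdiv k (pe2 k)](addrK (pe1 k)) IH polyC_natr rmorphB rmorphMn /=.
by rewrite mulrSr; ring.
Qed.

Lemma peuler_pe1 k : peuler k (pe1 k) = pe1 k.
Proof.
elim: k => //= k IH.
rewrite raddfD /= map_polyC /= IH (derivation_mapX (@peuler_derivation k)).
by rewrite derivD derivC derivX add0r mulr1 addr0.
Qed.

Lemma peuler_pe2 k : peuler k (pe2 k) = pe2 k *+ 2.
Proof.
elim: k => [|k IH] /=; first by rewrite mul0rn.
rewrite raddfD /= map_polyC /= (derivation_map (@peuler_derivation k)).
rewrite map_polyC /= peuler_pe1 (derivation_mapX (@peuler_derivation k)) IH.
rewrite derivD derivM !derivC derivX mulrnDl raddfMn /=; ring.
Qed.

Definition pmoment k m n : R := pint k (pe2 k ^+ m * pe1 k ^+ n).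

(** Expanding by the binomial formula, [i] counts the factors [pe1 k * 'X] taken from [pe2] and [j]
    the factors ['X] taken from [pe1]. *)
Lemma polyGamma_expand k m n :
  polyGamma (pe2 k.+1 ^+ m * pe1 k.+1 ^+ n) =
  \sum_(i < m.+1) \sum_(j < n.+1)
    (pe2 k ^+ (m - i) * pe1 k ^+ (i + (n - j))) *+
    ('C(m, i) * 'C(n, j) * (i + j)`!).
Proof.
rewrite /= !exprDn mulr_suml raddf_sum; apply: eq_bigr => i _.
rewrite mulr_sumr raddf_sum; apply: eq_bigr => j _.
rewrite exprMn mulrnAl mulrnAr -!rmorphXn /=.
rewrite [X in polyGamma (X *+ _ *+ _)](_ : _ =
  (pe2 k ^+ (m - i) * pe1 k ^+ (i + (n - j)))%:P * 'X^(i + j)); last first.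
  by rewrite exprD !exprD !rmorphM /=; ring.
rewrite !raddfMn /= polyGammaCM polyGammaXn mulr_natr -!mulrnA.
by congr (_ *+ _); rewrite mulnC (mulnC 'C(n, j)).
Qed.

Lemma pmomentS k m n : pmoment k.+1 m n =
  \sum_(i < m.+1) \sum_(j < n.+1)
    pmoment k (m - i) (i + (n - j)) *+ ('C(m, i) * 'C(n, j) * (i + j)`!).
Proof.
rewrite /pmoment [LHS](congr1 (pint k) (polyGamma_expand k m n)).
by rewrite raddf_sum; apply: eq_bigr => i _; rewrite raddf_sum;
  apply: eq_bigr => j _; rewrite raddfMn.
Qed.

Lemma coef0_moment k m n :
  (pe2 k.+1 ^+ m * pe1 k.+1 ^+ n)`_0 = pe2 k ^+ m * pe1 k ^+ n.
Proof. by rewrite -horner_coef0 /= !hornerE. Qed.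

(** By symmetry all [k.+1] faces contribute equally. The encoding orders the variables, so symmetry
    is replaced by induction: the outermost face is read off at ['X = 0], the others after
    integrating out ['X]. *)
Lemma pbound_moment k m n :
  pbound k.+1 (pe2 k.+1 ^+ m * pe1 k.+1 ^+ n) = pmoment k m n *+ k.+1.
Proof.
have pboundS j m' n' : pbound j.+1 (pe2 j.+1 ^+ m' * pe1 j.+1 ^+ n') =
    pbound j (polyGamma (pe2 j.+1 ^+ m' * pe1 j.+1 ^+ n')) + pmoment j m' n'.
  exact: (congr1 (fun z => pbound j (polyGamma _) + pint j z)
    (coef0_moment j m' n')).
elim: k m n => [|k IH] m n; first by rewrite pboundS add0r.
rewrite pboundS mulrSr; congr (_ + _).
rewrite [LHS](congr1 (pbound k.+1) (polyGamma_expand k.+1 m n)).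
rewrite pmomentS -sumrMnl raddf_sum; apply: eq_bigr => i _.
rewrite -sumrMnl raddf_sum; apply: eq_bigr => j _.
by rewrite raddfMn [X in X *+ _]IH -!mulrnA mulnC.
Qed.

(** The integrand is homogeneous of degree [2 * m + n], hence an eigenvector of [peuler];
    [pint_euler] adds the [k]. *)
Lemma pmoment_e1 k m n : pmoment k m n.+1 = pmoment k m n *+ (2 * m + n + k).
Proof.
rewrite /pmoment exprS mulrCA -pint_euler peuler_derivation.
rewrite !(derivationXn _ _ (@peuler_derivation k)) peuler_pe1 peuler_pe2.
rewrite mulrnDr; congr (_ + _); rewrite -[RHS]raddfMn; congr (pint k _).
(* At [i = 0], where the predecessor truncates, both sides vanish. *)
have exprP (x : polyn k) i : x * x ^+ i.-1 *+ i = x ^+ i *+ i.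
  by case: i => //= i; rewrite exprS.
rewrite [pe2 k *+ 2 * _]mulrnAl (mulrnAC _ 2) !exprP mulrnAr !mulrnAl.
by rewrite -mulrnA -mulrnDr (mulnC m).
Qed.

(** This is [pint_div] at [pe2 k.+1 ^+ m.+1]: the faces give the moment in [k] variables, the
    derivative gives the one with a factor [e1]. *)
Lemma pmoment_e2 k m : pmoment k.+1 m.+1 0 *+ k.+1 =
  pmoment k m.+1 0 *+ k.+1 + pmoment k.+1 m 1 *+ (m.+1 * k).
Proof.
have := pint_div (pe2 k.+1 ^+ m.+1 * pe1 k.+1 ^+ 0).
rewrite pbound_moment => /eqP; rewrite eq_sym subr_eq => /eqP ->.
rewrite addrC; congr (_ + _); rewrite mulr1 derivationXn; last first.
  exact: pdiv_derivation.
have -> : pdiv k.+1 (pe2 k.+1) = pe1 k.+1 *+ k.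
  by apply: (@addIr _ (pe1 k.+1)); rewrite pdiv_pe2 mulrSr.
by rewrite /pmoment expr1 mulrnAl -mulrnA mulnC mulrC raddfMn.
Qed.

End iterated_polynomials.

(** * The Gamma integral over the half-line *)

Section gamma_integral.
Variable R : realType.
Implicit Types (p : {poly R}) (x : R).

Lemma cvg_expn_expRN n : x ^+ n * expR (- x) @[x --> +oo] --> (0 : R).
Proof.
have cvg0 : (n.+1`!)%:R * x^-1 @[x --> +oo] --> (0 : R).
  rewrite -[X in _ --> X](mulr0 (n.+1`!)%:R); apply: cvgMl_tmp.
  apply/gtr0_cvgV0; last exact: cvg_id.
  by near=> x; near: x; apply: nbhs_pinfty_gt; exact: num_real.
apply: squeeze_cvgr cvg0; last exact: cvg_cst.
near=> x.
have x0 : 0 < x by near: x; apply: nbhs_pinfty_gt; exact: num_real.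
rewrite mulr_ge0 ?exprn_ge0 ?expR_ge0 ?(ltW x0)//=.
rewrite expRN ler_pdivrMr ?expR_gt0// mulrAC ler_pdivlMr// -exprSr.
have := expR_ge1Dxn n (ltW x0).
rewrite -lerBrDl ler_pdivrMr ?ltr0n ?fact_gt0// mulrC => /le_trans; apply.
by rewrite ler_pM2l ?ltr0n ?fact_gt0// gerBl.
Unshelve. all: by end_near. Qed.

Lemma cvg_horner_expRN p : p.[x] * expR (- x) @[x --> +oo] --> (0 : R).
Proof.
(* The extra power absorbs the ['X] split off by the induction on [p]. *)
suff H n : p.[x] * (x ^+ n * expR (- x)) @[x --> +oo] --> (0 : R).
  by have := H 0; under eq_fun do rewrite expr0 mul1r.
elim/poly_ind: p n => [|p c IH] n.
  by under eq_fun do rewrite horner0 mul0r; exact: cvg_cst.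
have -> : (fun x => (p * 'X + c%:P).[x] * (x ^+ n * expR (- x))) =
    (fun x => p.[x] * (x ^+ n.+1 * expR (- x))) \+
    (fun x => c * (x ^+ n * expR (- x))).
  by apply/funext => x /=; rewrite hornerMXaddC exprS; ring.
rewrite -[X in _ --> X]addr0; apply: cvgD; first exact: IH.
rewrite -[X in _ --> X](mulr0 c); apply: cvgMl_tmp; exact: cvg_expn_expRN.
Qed.

Lemma is_derive_horner_expRN p x :
  is_derive x 1 (fun t => - (p.[t] * expR (- t)))
    ((p - p^`()).[x] * expR (- x)).
Proof.
have dp : is_derive x 1 (horner p) p^`().[x].
  apply: DeriveDef; first exact: derivable_horner.
  by rewrite -derive1E -derivE.
have de : is_derive x 1 (fun t => expR (- t)) (- expR (- x)).
  rewrite -mulrN1.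
  exact: (@is_derive1_comp _ expR -%R x _ _ (is_derive_expR (- x))).
apply: is_derive_eq.
by rewrite hornerD hornerN /GRing.scale /=; ring.
Qed.

(** Then [- (p * expR (- x))] is a primitive of [x ^+ n * expR (- x)], and [p.[0]] is the value of
    the integral. *)
Lemma gamma_primitive n : exists2 p : {poly R},
  p - p^`() = 'X^n & p.[0] = (n`!)%:R.
Proof.
elim: n => [|n [p pX p0]].
  by exists 1; rewrite ?derivC ?subr0 ?hornerC.
exists ('X^(n.+1) + p *+ n.+1 : {poly R}); last first.
  by rewrite hornerD hornerMn hornerXn p0 expr0n add0r factS mulrnA mulrnAC.
by rewrite derivD derivXn derivMn /= -pX mulrnBl; ring.
Qed.

Lemma integral_gamma n : (\int[@lebesgue_measure R]_(x in `[0%R, +oo[)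
  (x ^+ n * expR (- x))%:E = (n`!%:R)%:E)%E.
Proof.
have [p pX p0] := gamma_primitive n.
have cF (q : {poly R}) : continuous (fun x : R => q.[x] * expR (- x)).
  move=> x; apply: continuousM; first exact: continuous_horner.
  by apply: continuous_comp; [exact: opp_continuous|exact: continuous_expR].
have dF := is_derive_horner_expRN p.
rewrite (@ge0_continuous_FTC2y _ _ (fun t => - (p.[t] * expR (- t))) _ 0).
- by rewrite oppr0 expR0 mulr1 p0 EFinN sub0e oppeK.
- by move=> x x0; rewrite mulr_ge0 ?exprn_ge0 ?expR_ge0.
- apply: continuous_subspaceT => x.
  by under eq_fun do rewrite -hornerXn; exact: cF.
- by rewrite -oppr0; apply: cvgN; exact: cvg_horner_expRN.
- by move=> x _; have [] := dF x.
- by apply: cvg_at_right_filter; apply: cvgN; exact: cF.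
- by move=> x _; rewrite derive1E; have [_ ->] := dF x; rewrite pX hornerXn.
Qed.

End gamma_integral.

(** * The Lebesgue integral over the orthant equals the algebraic one *)

Section orthant_integral.
Variable R : realType.

Lemma tnth_consRS k (p : measurableTypeR R * Rn R k) i :
  tnth (consR p) (lift ord0 i) = tnth p.2 i.
Proof. exact: tnthS. Qed.

Lemma e1_cons k (p : measurableTypeR R * Rn R k) :
  e1 (consR p) = p.1 + e1 p.2.
Proof.
rewrite /e1 big_ord_recl; congr (_ + _).
by apply: eq_bigr => i _; rewrite tnth_consRS.
Qed.

Lemma e2_cons k (p : measurableTypeR R * Rn R k) :
  e2 (consR p) = e2 p.2 + e1 p.2 * p.1.
Proof.
rewrite /e2 big_ord_recl addrC; congr (_ + _).
- apply: eq_bigr => i _; rewrite big_mkcond big_ord_recl /= add0r.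
  rewrite [RHS]big_mkcond; apply: eq_bigr => j _ /=.
  by rewrite !tnth_consRS /bump !add1n ltnS.
- rewrite big_mkcond big_ord_recl /= add0r /e1 mulr_suml.
  by apply: eq_bigr => i _; rewrite tnth_consRS mulrC.
Qed.

Lemma orthant_cons k (p : measurableTypeR R * Rn R k) :
  orthant R k.+1 (consR p) <-> 0 <= p.1 /\ orthant R k p.2.
Proof.
split=> [p0|[p10 p20] i].
  by split=> [|i]; [exact: (p0 ord0)|rewrite -tnth_consRS; exact: p0].
by case: (unliftP ord0 i) => [j|] -> //; rewrite tnth_consRS.
Qed.

Lemma measurable_orthant k : measurable (orthant R k).
Proof.
have -> : orthant R k = box (fun=> `[0%R, +oo[%classic).
  by apply/seteqP; split=> x /= x0 i; have := x0 i; rewrite /= in_itv/= andbT.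
by apply: (lebesgueRn_box _).1 => i; exact: measurable_itv.
Qed.

Lemma measurable_e1 k : measurable_fun setT (@e1 R k).
Proof.
by apply: measurable_sum => i; exact: (@measurable_tnth _ (measurableTypeR R)).
Qed.

Lemma measurable_e2 k : measurable_fun setT (@e2 R k).
Proof.
apply: measurable_sum => i.
have -> : (fun x : Rn R k => \sum_(j < k | (i < j)%N) tnth x i * tnth x j : R) =
    (fun x => \sum_(j < k) if (i < j)%N then tnth x i * tnth x j else 0 : R).
  by apply/funext => x; exact: big_mkcond.
apply: measurable_sum => j; case: (i < j)%N; last exact: measurable_cst.
by apply: measurable_funM; exact: (@measurable_tnth _ (measurableTypeR R)).
Qed.

Lemma e1_ge0 k (x : Rn R k) : orthant R k x -> 0 <= e1 x.
Proof. by move=> x0; apply: sumr_ge0. Qed.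

Lemma e2_ge0 k (x : Rn R k) : orthant R k x -> 0 <= e2 x.
Proof.
by move=> x0; do 2 (apply: sumr_ge0 => ? _); apply: mulr_ge0.
Qed.

Local Open Scope ereal_scope.

(** The measure is the pushforward of a product along [consR]: change variables, then apply
    Tonelli. *)
Lemma integral_lebesgueRnS k (f : Rn R k.+1 -> \bar R) :
  measurable_fun setT f -> (forall x, 0 <= f x) ->
  \int[lebesgueRn R k.+1]_x f x =
  \int[@lebesgue_measure R]_a \int[lebesgueRn R k]_y f (consR (a, y)).
Proof.
move=> mf f0.
transitivity
  (\int[@lebesgue_measure R \x lebesgueRn R k]_p (f \o @consR R k) p).
  rewrite -[in RHS](preimage_setT (@consR R k)).
  rewrite -(ge0_integral_pushforward (@measurable_consR R k))//.
rewrite fubini_tonelli1//; last by move=> p; exact: f0.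
by apply: measurableT_comp => //; exact: measurable_consR.
Qed.

Definition weight k m n (x : Rn R k) : R :=
  (e2 x ^+ m * e1 x ^+ n * expR (- e1 x))%R.

Lemma measurable_weight k m n : measurable_fun setT (@weight k m n).
Proof.
apply: measurable_funM.
  by apply: measurable_funM; apply: measurable_funX;
    [exact: measurable_e2|exact: measurable_e1].
apply: measurableT_comp => //; apply: measurableT_comp => //.
exact: measurable_e1.
Qed.

Lemma weight_ge0 k m n (x : Rn R k) : orthant R k x -> (0 <= weight m n x)%R.
Proof.
move=> x0; rewrite /weight mulr_ge0 ?expR_ge0// mulr_ge0// exprn_ge0//.
  exact: e2_ge0.
exact: e1_ge0.
Qed.

(** Same binomial expansion as [polyGamma_expand], indexed by pairs so that a single exchange of sum
    and integral is needed. *)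
Lemma weight_cons k m n a (y : Rn R k) : weight m n (consR (a, y)) =
  (\sum_(p : 'I_m.+1 * 'I_n.+1)
    (a ^+ (p.1 + p.2) * expR (- a) * ('C(m, p.1) * 'C(n, p.2))%:R) *
    weight (m - p.1) (p.1 + (n - p.2)) y)%R.
Proof.
rewrite -(pair_bigA _ (fun (i : 'I_m.+1) (j : 'I_n.+1) =>
  (a ^+ (i + j) * expR (- a) * ('C(m, i) * 'C(n, j))%:R) *
  weight (m - i) (i + (n - j)) y)%R) /=.
rewrite /weight e1_cons e2_cons /= [(a + _)%R]addrC.
move: (e1 y) (e2 y) => u v; rewrite !exprDn !mulr_suml.
apply: eq_bigr => i _; rewrite mulr_sumr mulr_suml; apply: eq_bigr => j _.
rewrite opprD expRD exprMn !exprD natrM -[in LHS]mulr_natr.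
by rewrite -[(_ *+ 'C(n, j))%R]mulr_natr; ring.
Qed.

Lemma orthant_integralS k (f : Rn R k.+1 -> \bar R) :
  measurable_fun setT f -> (forall x, orthant R k.+1 x -> 0 <= f x) ->
  \int[lebesgueRn R k.+1]_(x in orthant R k.+1) f x =
  \int[@lebesgue_measure R]_(a in `[0%R, +oo[)
    \int[lebesgueRn R k]_(y in orthant R k) f (consR (a, y)).
Proof.
move=> mf f0; rewrite integral_mkcond integral_lebesgueRnS; first last.
- by move=> x; rewrite erestrict_ge0.
- apply/(measurable_restrictT _ _).1; first exact: measurable_orthant.
  exact: measurable_funTS.
rewrite [RHS]integral_mkcond; apply: eq_integral => a _.
rewrite patchE; case: ifPn => a0.
- rewrite [RHS]integral_mkcond; apply: eq_integral => y _.
  rewrite !patchE; congr (if _ then _ else _).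
  move: a0; rewrite inE /= in_itv/= andbT => a0.
  apply/idP/idP; rewrite !inE; first by move/orthant_cons => -[].
  by move=> y0; apply/orthant_cons.
(* For [a < 0] the slice of the orthant is empty. *)
- rewrite integral0_eq// => y _; rewrite patchE ifF//.
  apply/negP; rewrite inE => /orthant_cons[/= a_ge0 _]; move/negP: a0; apply.
  by rewrite inE /= in_itv/= a_ge0.
Qed.

Lemma integral_weight k m n :
  \int[lebesgueRn R k]_(x in orthant R k) (weight m n x)%:E =
  (pmoment R k m n)%:E.
Proof.
elim: k m n => [|k IH] m n.
  (* In dimension 0 the measure is the Dirac mass at the empty tuple, which lies in the orthant. *)
  rewrite [LHS]integral_dirac; first last.
    by apply/measurable_funTS/measurable_EFinP; exact: measurable_weight.
    exact: measurable_orthant.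
  rewrite diracE mem_set; last by case.
  by rewrite mul1e /weight /e1 /e2 !big_ord0 oppr0 expR0 mulr1.
pose c (p : 'I_m.+1 * 'I_n.+1) : R := ('C(m, p.1) * 'C(n, p.2))%:R.
pose M (p : 'I_m.+1 * 'I_n.+1) := pmoment R k (m - p.1) (p.1 + (n - p.2)).
(* Positivity of the algebraic moments is read off from the integrals they equal by induction. *)
have M_ge0 p : (0 <= M p)%R.
  rewrite -lee_fin -IH; apply: integral_ge0 => x x0.
  by rewrite lee_fin weight_ge0.
have mg i : measurable_fun setT (fun a : R => a ^+ i * expR (- a))%R.
  by apply: measurable_funM => //; exact: measurableT_comp.
have g_ge0 (i : nat) (a : R) : `[0%R, +oo[%classic a ->
    (0 <= a ^+ i * expR (- a))%R.
  by rewrite /= in_itv/= andbT => a0; rewrite mulr_ge0 ?exprn_ge0 ?expR_ge0.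
rewrite orthant_integralS; first last.
- by move=> x x0; rewrite lee_fin weight_ge0.
- by apply/measurable_EFinP; exact: measurable_weight.
transitivity (\int[@lebesgue_measure R]_(a in `[0%R, +oo[)
    \sum_(p : 'I_m.+1 * 'I_n.+1)
      (c p * M p)%:E * (a ^+ (p.1 + p.2) * expR (- a))%:E).
  apply: eq_integral => a; rewrite inE => a0.
  under eq_integral do rewrite weight_cons -sumEFin.
  rewrite ge0_integral_sum; first last.
  - move=> p y y0; rewrite lee_fin mulr_ge0 ?weight_ge0// mulr_ge0//.
    exact: g_ge0.
  - move=> p; apply/measurable_EFinP/measurable_funTS.
    apply: measurable_funM => //.
    exact: measurable_weight.
  - exact: measurable_orthant.
  apply: eq_bigr => p _; under eq_integral do rewrite EFinM.
  rewrite ge0_integralZl_EFin.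
  + by rewrite IH -!EFinM; congr EFin; rewrite /M /c; ring.
  + exact: measurable_orthant.
  + by move=> y y0; rewrite lee_fin weight_ge0.
  + by apply/measurable_EFinP/measurable_funTS; exact: measurable_weight.
  + by rewrite mulr_ge0//; exact: g_ge0.
rewrite ge0_integral_sum//; first last.
- move=> p a a0; rewrite mule_ge0// lee_fin; last exact: g_ge0.
  by rewrite mulr_ge0 ?M_ge0.
- move=> p; apply: measurable_funeM.
  by apply/measurable_EFinP/measurable_funTS; exact: mg.
rewrite pmomentS pair_bigA -sumEFin; apply: eq_bigr => p _.
rewrite ge0_integralZl_EFin//; first last.
- by rewrite mulr_ge0.
- apply/measurable_EFinP/measurable_funTS. exact: mg.
- by move=> a a0; rewrite lee_fin; exact: g_ge0.
rewrite integral_gamma -EFinM; congr EFin.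
by rewrite /c /M -[RHS]mulr_natr [in RHS]natrM; ring.
Qed.

End orthant_integral.

(** * Closed form of the moments through the recurrence of [T] *)

Section closed_form.
Variable R : realType.

Lemma pmoment_fact k m n : pmoment R k.+1 m n * ((2 * m + k)`!)%:R =
  pmoment R k.+1 m 0 * ((2 * m + n + k)`!)%:R.
Proof.
elim: n => [|n IH]; first by rewrite addn0.
rewrite pmoment_e1 (addnS (2 * m)) addSn.
by rewrite factS natrM mulrCA -IH mulrnAl mulr_natl addnS.
Qed.

(** Eliminates the moment with a factor [e1] between [pmoment_e2] and [pmoment_e1]. *)
Lemma pmoment_rec k m : pmoment R k.+1 m.+1 0 =
  pmoment R k m.+1 0 +
  m.+1%:R * k%:R * (2 * m + k.+1)%:R / k.+1%:R * pmoment R k.+1 m 0.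
Proof.
have k0 : k.+1%:R != 0 :> R by rewrite pnatr_eq0.
apply: (mulfI k0); rewrite !mulr_natl pmoment_e2 pmoment_e1 addn0 mulrnDl.
congr (_ + _); rewrite -mulrnA -[LHS]mulr_natr -[RHS]mulr_natr !natrM.
field; by rewrite addrC natr1.
Qed.

Lemma pmoment00 k : pmoment R k 0 0 = 1.
Proof.
elim: k => [|k IH]; first by rewrite /pmoment mulr1.
by rewrite pmomentS !big_ord1 IH.
Qed.

Lemma pmoment1 m : pmoment R 1 m.+1 0 = 0.
Proof.
by rewrite /pmoment /= mul0r addr0 expr0n mul0r raddf0.
Qed.

Lemma risingS (y : R) m : rising y m.+1 = rising y m * (y + m%:R).
Proof. by rewrite /rising big_ord_recr. Qed.

Lemma rising_gt0 (y : R) m : 0 < y -> 0 < rising y m.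
Proof. by move=> y0; apply: prodr_gt0 => i _; rewrite ltr_wpDr. Qed.

(** Times its prefactor, the recurrence of [T] becomes [pmoment_rec] term by term. At [k.+1 = 1],
    [m = 0] the moment is 1 whereas [T 1 0 = 0]. *)
Lemma pmoment_closed (T : nat -> nat -> R) k m : is_T T ->
  ~ (k.+1 = 1%N /\ m = 0%N) ->
  pmoment R k.+1 m 0 = (m`!)%:R * rising (k.+1%:R / 2) m
   * (2 * (k.+1%:R - 1) / k.+1%:R) ^+ m * T k.+1 m.
Proof.
move=> [Trec T1 T0]; elim: k m => [|k IHk] m.
  by case: m => [[]//|m] _; rewrite T1 mulr0 pmoment1.
elim: m => [|m IHm] _; first by rewrite pmoment00 T0// /rising big_ord0 !mulr1.
rewrite pmoment_rec IHm; last by case.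
rewrite IHk; last by case.
have := Trec k.+2 m.+1 isT isT.
rewrite !subn1 /= => /eqP; rewrite subr_eq => /eqP ->.
set t := T k.+2 m; set t' := T k.+1 m.+1.
rewrite [RHS]mulrDr; congr (_ + _).
- rewrite /T_coef -[k.+2%:R]natr1 addrK.
  have a0 : 0 < k.+1%:R :> R by rewrite ltr0Sn.
  move: (k.+1%:R : R) a0 => a a0.
  have a0' : a != 0 by rewrite gt_eqF.
  have a1 : a + 1 != 0 by rewrite gt_eqF// ltr_wpDr.
  (* The geometric factors for [k.+1] and [k.+2] variables differ by the powers in [T_coef]. *)
  have -> : (2 * (a - 1) / a) ^+ m.+1 = (2 * a / (a + 1)) ^+ m.+1 *
      ((a + 1) * (a + 1 - 2)) ^+ m.+1 / a ^+ (2 * m.+1).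
    by rewrite exprM -exprVn -!exprMn; congr (_ ^+ _); field; rewrite a0' a1.
  have : rising ((a + 1) / 2) m.+1 != 0.
    by rewrite gt_eqF// rising_gt0// divr_gt0// ltr_wpDr.
  have : a ^+ (2 * m.+1) != 0 by rewrite expf_neq0.
  move: (rising _ _) (rising _ _) (_ ^+ _) (_ ^+ _) (_ ^+ _) => x y z u v *.
  by field; apply/andP.
- have k2 : k.+2%:R != 0 :> R by rewrite pnatr_eq0.
  rewrite risingS factS natrM exprS natrD natrM.
  move: (_ ^+ m) (rising _ m) => q r.
  by field; rewrite -natrD add2n.
Qed.
End closed_form.

Theorem mainTheorem1 (R : realType) (T : nat -> nat -> R) (hT : is_T T)
    (k m n : nat) (hk : (1 <= k)%N)
    (hkm : ~ (k = 1%N /\ m = 0%N)) :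
  (\int[lebesgueRn R k]_(x in orthant R k)
      ((e2 x) ^+ m * (e1 x) ^+ n * expR (- e1 x))%:E)%E =
  ((m`!)%:R * ((2 * m + n + k - 1)`!)%:R * rising (k%:R / 2) m
     / ((2 * m + k - 1)`!)%:R
   * (2 * (k%:R - 1) / k%:R) ^+ m * T k m)%:E.
Proof.
case: k hk hkm => // k _ hkm; rewrite [LHS](integral_weight R k.+1 m n).
congr EFin; rewrite !addnS !subn1 /=.
have fact_neq0 : ((2 * m + k)`!)%:R != 0 :> R.
  by rewrite pnatr_eq0 -lt0n fact_gt0.
(* Multiplying and dividing by this factorial reduces to [n = 0]. *)
rewrite -[LHS](mulfK fact_neq0) pmoment_fact (pmoment_closed hT hkm).
by ring.
Qed.
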